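(* Let $A \in L(\mathcal{H})$ have closed range and let $W \in L(\mathcal{H})^{+}$ be such that the pair $(W, R(A))$ is compatible. For $X\in L(\mathcal{H})$ put $F(X)=(AX-I)^{*}W(AX-I)$, and let $M=\{X\in L(\mathcal{H}): F(X)=W_{/R(A)}\}$. For $X_0\in L(\mathcal{H})$ the following conditions are equivalent: (i) $X_0 \in M$, i.e. $F(X_0)=\min_{X \in L(\mathcal{H})} F(X)$ (minimum in the operator order); (ii) $X_0$ is a $W$-inverse of $A$; (iii) $X_0$ is a solution of the normal equation $A^{*}W(AX-I)=0$.
   Context: $\mathcal{H}$ is a separable complex Hilbert space, $L(\mathcal{H})$ is the algebra of bounded linear operators on $\mathcal{H}$, $L(\mathcal{H})^{+}$ is the cone of positive semidefinite operators, $I$ is the identity operator, and $R(T)$ denotes the range of $T$. The operator order is: $S\le T$ if $T-S\in L(\mathcal{H})^{+}$. For $W\in L(\mathcal{H})^{+}$ and a closed subspace $\mathcal{S}\subseteq\mathcal{H}$, the shorted operator of $W$ to $\mathcal{S}$ is $W_{/\mathcal{S}}=\max\{X\in L(\mathcal{H}): 0\le X\le W \text{ and } R(X)\subseteq \mathcal{S}^{\perp}\}$ (this maximum is known to exist). The pair $(W,\mathcal{S})$ is compatible if there exists $Q\in L(\mathcal{H})$ with $Q^2=Q$, $R(Q)=\mathcal{S}$ and $WQ=Q^{*}W$. Let $\Vert x\Vert_W=\langle Wx,x\rangle^{1/2}$. An operator $X_0\in L(\mathcal{H})$ is a $W$-inverse of $A$ if $\Vert AX_0x-x\Vert_W\le\Vert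 Az-x\Vert_W$ for every $x,z\in\mathcal{H}$. *)

(* Defs.v *)
From mathcomp Require Import all_boot all_order all_algebra.
From mathcomp Require Import all_classical all_reals all_analysis.
From mathcomp Require Import complex.
Import Order.TTheory GRing.Theory Num.Theory.
Import numFieldNormedType.Exports.

Set Implicit Arguments.
Unset Strict Implicit.
Unset Printing Implicit Defensive.

Local Open Scope classical_set_scope.
Local Open Scope ring_scope.
Local Open Scope complex_scope.

Definition separable (T : topologicalType) :=
  exists2 D : set T, countable D & dense D.

Section HilbertOperators.
Context (R : realType) (H : normedModType R[i]).

(* L(H), as a set of functions: for linear maps, bounded means continuous. *)
Definition bounded_op : set (H -> H) := [set T | linear T /\ continuous T].

(* Conventions: [inner] is linear on the left and conjugate-linear on the
   right. In the partial order of R[i], 0 <= z means that z is real and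
   nonnegative. *)
Context (inner : {dot H for @Num.conj R[i]}).

(* When H is complete for the norm of [inner], every T in L(H) has exactly one
   such S, which is again in L(H) (Riesz); the value 0 is never used then. *)
Definition adjoint (T : H -> H) : H -> H :=
  xget (fun=> 0) [set S | forall x y, inner (T x) y = inner x (S y)].

Definition positive_op : set (H -> H) :=
  [set T | bounded_op T /\ forall x, 0 <= inner (T x) x].

Definition op_le (S T : H -> H) := positive_op (T \- S).

Definition op_max (E : set (H -> H)) (T : H -> H) :=
  E T /\ forall X, E X -> op_le X T.

Definition op_min (E : set (H -> H)) (T : H -> H) :=
  E T /\ forall X, E X -> op_le T X.

Definition orthogonal_complement (S : set H) : set H :=
  [set y | forall x, S x -> inner x y = 0].

(* The maximum is unique, and exists for W positive and S a closed subspace. *)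
Definition shorted (W : H -> H) (S : set H) : H -> H :=
  xget (fun=> 0) (op_max [set X | [/\ bounded_op X, op_le (fun=> 0) X,
    op_le X W & range X `<=` orthogonal_complement S]]).

Definition compatible (W : H -> H) (S : set H) :=
  exists Q : H -> H, [/\ bounded_op Q, Q \o Q = Q, range Q = S &
    W \o Q = adjoint Q \o W].

Definition seminorm_op (W : H -> H) (x : H) : R[i] := sqrtC (inner (W x) x).

Definition W_inverse (W A X0 : H -> H) :=
  bounded_op X0 /\ forall x z,
    seminorm_op W (A (X0 x) - x) <= seminorm_op W (A z - x).

Definition residual_op (A W X : H -> H) : H -> H :=
  adjoint (A \o X \- idfun) \o W \o (A \o X \- idfun).

Definition residual_shorted (A W : H -> H) : set (H -> H) :=
  [set X | bounded_op X /\ residual_op A W X = shorted W (range A)].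

Definition normal_equation (A W X : H -> H) :=
  adjoint A \o W \o (A \o X \- idfun) = (fun=> 0).

End HilbertOperators.

(* Main.v *)
Require Import Defs.
From HB Require Import structures.
From mathcomp Require Import all_boot all_order all_algebra.
From mathcomp Require Import all_classical all_reals all_analysis.
From mathcomp Require Import complex.
From mathcomp Require Import ring.
Import Order.TTheory GRing.Theory Num.Theory.
Import numFieldNormedType.Exports.

Set Implicit Arguments.
Unset Strict Implicit.
Unset Printing Implicit Defensive.

Local Open Scope classical_set_scope.
Local Open Scope ring_scope.
Local Open Scope complex_scope.

(** Why the theorem holds. Write [q v] for [inner (W v) v] and [u_x] for the
    residual [A (X x) - x]. The operator [residual_op inner A W X] represents
    the quadratic form sending [x] to [q u_x], so every clause is about making
    [q u_x] small.

    A projection [Q] onto [range A] with [W Q = Q^* W] is orthogonal for the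
    semi-inner product defined by [W], which gives the Pythagorean identity
    [q u = q (Q u) + q (u - Q u)] ([compatible_pythagoras]). Two consequences:
    - the shorted operator is explicitly [W (1 - Q)] ([shorted_compatible]),
      because a positive [X <= W] with range orthogonal to [range Q] vanishes on
      [range Q], hence
      [<X x, x> = <X (x - Q x), x - Q x> <= q (x - Q x)];
    - since [u_x - Q u_x = - (x - Q x)] whatever [X] is, [W (1 - Q)] is a lower
      bound of all residual operators ([shorted_le_residual]), so reaching it
      means reaching the minimum.

    A minimum in the operator order is a pointwise minimum over all right-hand
    sides [A z], because a rank-one perturbation of [X0] can be given any
    value [z] at a fixed nonzero [x] ([W_inverse_of_min]). Pointwise minimality
    on the affine space [A (X0 x) - x + range A] forces the first variation to
    vanish, which is the normal equation ([normal_equation_of_W_inverse]).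
    Finally, if the normal equation holds then [A (X0 x) - Q x] lies in
    [range A] and is [W]-orthogonal to it, so [q] vanishes there; a zero of
    [q] is a minimiser of [q], so [W] vanishes there too, and the residual operator equals [W (1 - Q)]
    ([residual_of_normal_equation]).

    To make sense of adjoints, the Riesz representation theorem is proved by
    minimising [|x|^2 - 2 Re (f x)]. One elementary inequality on
    complex quadratic polynomials ([sqr_norm_le_of_quadratic]) gives
    Cauchy-Schwarz, the vanishing of first variations and the
    approximate Riesz representers. *)

(** * Positive sesquilinear forms *)

(** The discriminant inequality for a quadratic polynomial in a complex
    variable: minimise it along the direction [- c^*], where its linear term is
    most negative. Allowing a slack [e] makes it serve for exact and for
    approximate minimisers alike. *)
Lemma sqr_norm_le_of_quadratic (C : numClosedFieldType) (a c e : C) :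
  0 <= a -> 0 <= e ->
  (forall t : C, - e <= `|t| ^+ 2 * a + (t * c + (t * c)^*%R)) ->
  `|c| ^+ 2 <= e * a.
Proof.
move=> a0 e0 quad.
have quadN (s : C) : 0 <= s -> - e <= (s ^+ 2 * a - s *+ 2) * `|c| ^+ 2.
  move=> s0; have := quad (- s * c^*%R).
  have -> : - s * c^*%R * c = - (s * `|c| ^+ 2).
    by rewrite normCK !mulNr -mulrA [c^*%R * c]mulrC.
  rewrite normrM normrN norm_conjC (ger0_norm s0) rmorphN /=.
  rewrite (geC0_conj (mulr_ge0 s0 (exprn_ge0 2 (normr_ge0 c)))).
  by rewrite exprMn mulrAC mulrBl -opprD mulrnAl mulr2n.
(* For [a = 0] the polynomial is affine along this ray, so any step beyond
   [e / (2 |c|^2)] contradicts the bound unless [c = 0]; otherwise the minimum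
   along the ray is at [s = 1 / a]. *)
have [a_eq0|a_neq0] := eqVneq a 0.
  rewrite a_eq0 mulr0; have [->|c_neq0] := eqVneq c 0.
    by rewrite normr0 expr0n.
  have n0 : 0 < `|c| ^+ 2 by rewrite exprn_gt0 ?normr_gt0.
  have e1 : 0 <= (e + 1) / `|c| ^+ 2 by rewrite divr_ge0 ?addr_ge0 ?ler01 ?(ltW n0).
  have := quadN _ e1; rewrite a_eq0 mulr0 sub0r mulNr mulrnAl divfK ?gt_eqF//.
  rewrite lerN2 mulr2n -lerBrDr opprD addrA subrr sub0r => h.
  have := le_trans (addr_ge0 e0 ler01) h.
  by rewrite oppr_ge0 lt_geF.
have a_gt0 : 0 < a by rewrite lt0r a_neq0.
have ai0 : 0 <= a^-1 by rewrite invr_ge0.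
have := quadN _ ai0; rewrite expr2 mulfVK// mulr2n opprD addrA subrr sub0r.
by rewrite mulNr lerN2 mulrC ler_pdivrMr.
Qed.

(** Turns the predicate [linear] into the bundled structure, for which the
    additivity and scaling rules are available. *)
Lemma linear_pack (K : pzRingType) (U V : lmodType K) (T : U -> V) :
  linear T -> exists L : {linear U -> V}, T = L.
Proof.
move=> linT; pose linT_mixin := GRing.isLinear.Build K U V _ T linT.
by exists (HB.pack_for {linear U -> V} T linT_mixin).
Qed.

Lemma linear_sub (K : pzRingType) (U V : lmodType K) (T : U -> V) (x y : U) :
  linear T -> T (x - y) = T x - T y.
Proof. by move=> /linear_pack[L ->]; exact: linearB. Qed.

Section PositiveForm.
Context (C : numClosedFieldType) (U : lmodType C).
Context (inner : {dot U for @Num.conj C}).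

Lemma ipDl x y z : inner (x + y) z = inner x z + inner y z.
Proof. exact: linearDl. Qed.

Lemma ipDr x y z : inner x (y + z) = inner x y + inner x z.
Proof. exact: linearDr. Qed.

Lemma ipBl x y z : inner (x - y) z = inner x z - inner y z.
Proof. exact: linearBl. Qed.

Lemma ipBr x y z : inner x (y - z) = inner x y - inner x z.
Proof. exact: linearBr. Qed.

Lemma ip0l z : inner 0 z = 0.
Proof. exact: linear0l. Qed.

Lemma ip0r z : inner z 0 = 0.
Proof. exact: linear0r. Qed.

Lemma ipZl a x z : inner (a *: x) z = a * inner x z.
Proof. exact: (linearZl_LR inner). Qed.

Lemma ipZr a x z : inner z (a *: x) = a^*%R * inner z x.
Proof. exact: (linearZr_LR inner). Qed.

Lemma ipC x y : inner x y = (inner y x)^*%R.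
Proof. by rewrite (hermC inner) expr0 mul1r. Qed.

Lemma ip_eq0 x : (forall y, inner x y = 0) -> x = 0.
Proof. by move=> /(_ x)/eqP; rewrite dnorm_eq0 => /eqP. Qed.

(** Over the complex numbers reality of the quadratic form already forces
    symmetry: polarise along [x + t y] with [t = 1] and [t = 'i]. *)
Lemma real_form_hermitian (W : U -> U) (x y : U) : linear W ->
  (forall z, inner (W z) z \is Num.real) -> inner (W x) y = inner x (W y).
Proof.
move=> /linear_pack[{}W ->] W_real.
have cross t : t^*%R * inner (W x) y + t * inner (W y) x \is Num.real.
  have := W_real (x + t *: y).
  rewrite (linearD W) linearZ_LR ipDl !ipDr !ipZl !ipZr => h.
  have -> : t^*%R * inner (W x) y + t * inner (W y) x =
      (inner (W x) x + t^*%R * inner (W x) y +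
        (t * inner (W y) x + t * (t^*%R * inner (W y) y))) -
      inner (W x) x - `|t| ^+ 2 * inner (W y) y.
    by rewrite normCK; ring.
  by rewrite !rpredB// rpredM// rpredX// normr_real.
have /CrealP := cross 1; have /CrealP := cross 'i%R.
rewrite !rmorphD !rmorphM/= conjCK !conjCi rmorph1 !mul1r !mulNr.
rewrite [_ + 'i%R * _]addrC -!mulrBr => /(mulfI (neq0Ci _)) h1 h2.
rewrite [RHS]ipC; apply: (@pmulrnI _ 2%N) => //.
have -> : inner (W x) y *+ 2 = (inner (W x) y + inner (W y) x) -
  (inner (W y) x - inner (W x) y) by ring.
by rewrite -h1 -h2 rmorph1; ring.
Qed.

Section Positive.
Context (W : U -> U) (linW : linear W) (W_ge0 : forall z, 0 <= inner (W z) z).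

Lemma positive_form_hermitian x y : inner (W x) y = inner x (W y).
Proof. by apply: real_form_hermitian => // z; rewrite ger0_real. Qed.

Lemma positive_form_line u v t : inner (W (u + t *: v)) (u + t *: v) =
  inner (W u) u +
  (`|t| ^+ 2 * inner (W v) v + (t * inner (W v) u + (t * inner (W v) u)^*%R)).
Proof.
have Wuv : inner (W u) v = (inner (W v) u)^*%R.
  by rewrite positive_form_hermitian -ipC.
have [L WE] := linear_pack linW; rewrite WE in Wuv *.
rewrite (linearD L) linearZ_LR ipDl !ipDr !ipZl !ipZr Wuv rmorphM/= normCK.
by ring.
Qed.

Lemma positive_form_almost_min u v e : 0 <= e ->
  (forall t, inner (W u) u - e <= inner (W (u + t *: v)) (u + t *: v)) ->
  `|inner (W v) u| ^+ 2 <= e * inner (W v) v.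
Proof.
move=> e0 min; apply: sqr_norm_le_of_quadratic => // t.
by have := min t; rewrite positive_form_line lerD2l.
Qed.

(** The first variation vanishes at a minimiser. *)
Lemma positive_form_min u v :
  (forall t, inner (W u) u <= inner (W (u + t *: v)) (u + t *: v)) ->
  inner (W u) v = 0.
Proof.
move=> min; have : `|inner (W v) u| ^+ 2 <= 0 * inner (W v) v.
  by apply: positive_form_almost_min => // t; rewrite subr0.
rewrite mul0r positive_form_hermitian ipC norm_conjC => le0.
by apply/eqP; rewrite -normr_eq0 -sqrf_eq0 eq_le le0 exprn_ge0.
Qed.

(** As the form is nonnegative, every [u] is a minimiser up to the slack
    [inner (W u) u]. *)
Lemma positive_form_cauchy_schwarz u v :
  `|inner (W v) u| ^+ 2 <= inner (W u) u * inner (W v) v.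
Proof. by apply: positive_form_almost_min => // t; rewrite subrr. Qed.

(** A zero of the quadratic form is a minimiser in every direction. *)
Lemma positive_form_eq0 v : inner (W v) v = 0 -> W v = 0.
Proof.
move=> Wv0; apply: ip_eq0 => y.
by apply: positive_form_min => t; rewrite Wv0.
Qed.

End Positive.

Lemma cauchy_schwarz u v :
  `|inner u v| ^+ 2 <= inner u u * inner v v.
Proof.
by rewrite mulrC; apply: (@positive_form_cauchy_schwarz idfun) => // x.
Qed.

End PositiveForm.

(** * Riesz representation *)

Section Riesz.
Context (R : realType) (H : completeNormedModType R[i]).
Context (inner : {dot H for @Num.conj R[i]}).
Context (norm_inner : forall x : H, `|x| = sqrtC (inner x x)).

Lemma ip_norm x : inner x x = `|x| ^+ 2.
Proof. by rewrite norm_inner sqrtCK. Qed.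

Lemma norm_ip_le x y : `|inner x y| <= `|x| * `|y|.
Proof.
rewrite -(@ler_pXn2r _ 2%N) ?nnegrE ?mulr_ge0// exprMn -!ip_norm.
exact: cauchy_schwarz.
Qed.

Section Functional.
Context (f : H -> R[i]) (linf : scalar f) (M : R[i]).
Context (M_ge0 : 0 <= M) (f_le : forall x, `|f x| <= M * `|x|).

(** A representer [x] of [f] is a minimiser of this functional, since
    [phi y = |y - x|^2 - |x|^2] when [f = inner _ x]. *)
Let phi x := inner x x - (f x + (f x)^*%R).

Let phi_real x : phi x \is Num.real.
Proof.
apply: rpredB; first by rewrite ger0_real ?dnorm_ge0.
by apply/CrealP; rewrite rmorphD/= conjCK addrC.
Qed.

Let phi_ge x : - M ^+ 2 <= phi x.
Proof.
have fx : f x + (f x)^*%R <= (M * `|x|) *+ 2.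
  have fr : f x + (f x)^*%R \is Num.real.
    by apply/CrealP; rewrite rmorphD/= conjCK addrC.
  apply: le_trans (real_ler_norm fr) _.
  apply: le_trans (ler_normD _ _) _.
  by rewrite norm_conjC -mulr2n lerMn2r/= f_le.
rewrite /phi ip_norm -subr_ge0 opprK.
apply: (@le_trans _ _ ((`|x| - M) ^+ 2)).
  by rewrite real_exprn_even_ge0// rpredB// ger0_real.
rewrite -subr_ge0.
have -> : `|x| ^+ 2 - (f x + (f x)^*%R) + M ^+ 2 - (`|x| - M) ^+ 2 =
  (M * `|x|) *+ 2 - (f x + (f x)^*%R) by ring.
by rewrite subr_ge0.
Qed.

Let phi_line x h t : phi (x + t *: h) = phi x +
  (`|t| ^+ 2 * inner h h +
    (t * (inner h x - f h) + (t * (inner h x - f h))^*%R)).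
Proof.
rewrite /phi (@positive_form_line _ _ inner idfun)//=.
rewrite [x + _]addrC linf mulrBr !rmorphB/= rmorphD/= !rmorphM/=.
by ring.
Qed.

(** Near-minimisers of [phi] represent [f] approximately: if [phi x] is within
    [d ^+ 2] of the infimum, the quadratic inequality bounds the first variation
    [inner h x - f h] by [d * |h|]. *)
Lemma almost_riesz (d : R) : 0 < d ->
  exists x, forall h, `|f h - inner h x| <= d%:C * `|h|.
Proof.
move=> d0; pose E := [set complex.Re (phi x) | x in [set: H]].
have ReE x : (complex.Re (phi x))%:C = phi x by rewrite RRe_real.
have lbE : has_lbound E.
  exists (complex.Re (- M ^+ 2)) => _ [x _ <-].
  by have := phi_ge x; rewrite lecE => /andP[].
have infE : has_inf E by split => //; exists (complex.Re (phi 0)), 0.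
have [_ [x _ <-] xmin] := inf_adherent (exprn_gt0 2 d0) infE.
exists x => h; rewrite distrC.
rewrite -(@ler_pXn2r _ 2%N) ?nnegrE ?mulr_ge0 ?(ler0c d) ?(ltW d0)//.
rewrite exprMn -ip_norm.
apply: sqr_norm_le_of_quadratic; rewrite ?dnorm_ge0//.
  by rewrite exprn_ge0// ler0c ltW.
move=> t; rewrite -(lerD2l (phi x)) -phi_line lerBlDr.
rewrite -rmorphXn/= -[X in X <= _]ReE -[X in _ <= X + _]ReE -rmorphD/= lecR.
apply: (le_trans (ltW xmin)); rewrite lerD2r.
by apply: ge_inf => //; exists (x + t *: h).
Qed.

(** Approximate representers [x], [y] of precisions [d], [d'] satisfy
    [|inner h (x - y)| <= (d + d') |h|]; taking [h = x - y] shows that they form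
    a Cauchy sequence as the precision tends to [0], and its limit represents
    [f]. *)
Lemma riesz : exists x, forall h, f h = inner h x.
Proof.
have /choice[u uP] (n : nat) :
    exists x, forall h, `|f h - inner h x| <= (n.+1%:R^-1)%:C * `|h|.
  by apply: almost_riesz; rewrite invr_gt0.
have dist_u n m : (n <= m)%N -> `|u n - u m| <= ((n.+1%:R^-1)%:C) *+ 2.
  move=> nm; have [->|unm] := eqVneq (u n) (u m).
    by rewrite subrr normr0 mulrn_wge0// ler0c invr_ge0.
  have {}unm : 0 < `|u n - u m| by rewrite normr_gt0 subr_eq0.
  rewrite -(ler_pM2r unm) -expr2 -ip_norm.
  set h := u n - u m.
  rewrite -(ger0_norm (dnorm_ge0 inner h)).
  have -> : inner h h = (f h - inner h (u m)) - (f h - inner h (u n)).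
    by rewrite {2}/h ipBr; ring.
  apply: le_trans (ler_normB _ _) _; rewrite mulrnAl mulr2n.
  apply: lerD; last exact: uP.
  apply: le_trans (uP _ _) _; rewrite ler_wpM2r// lecR lef_pV2 ?posrE//.
  by rewrite ler_nat.
have small (e : R[i]) : 0 < e -> exists N, (N.+1%:R^-1)%:C < e.
  move=> e0; have eE : e = (complex.Re e)%:C by rewrite RRe_real ?gtr0_real.
  have {}e0 : 0 < complex.Re e by rewrite eE ltcR in e0.
  have [N _ NP] := near_infty_natSinv_lt (PosNum e0).
  by exists N; rewrite eE ltcR; apply: NP => /=.
have ucvg : cvg (u @ \oo).
  apply/cauchy_cvgP/cauchy_exP => e e0.
  have [N Ne] := small _ (divr_gt0 e0 (ltr0n _ 2%N)).
  exists (u N); exists N => // n /= Nn; rewrite -ball_normE/=.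
  by apply: le_lt_trans (dist_u _ _ Nn) _; rewrite ltr_pdivlMr// mulr_natr in Ne.
exists (lim (u @ \oo)) => h; apply/eqP/negPn/negP => neq.
pose g := `|f h - inner h (lim (u @ \oo))|.
have g0 : 0 < g by rewrite normr_gt0 subr_eq0.
have h1 : 0 < `|h| + 1 by rewrite ltr_wpDl.
pose e := g / 2%:R / (`|h| + 1).
have e0 : 0 < e by rewrite !divr_gt0.
have eE : (e * (`|h| + 1)) *+ 2 = g.
  by rewrite divfK ?gt_eqF// -mulr_natr divfK// pnatr_eq0.
have [N Ne] := small _ e0.
have /cvgrPdist_lt /(_ _ e0) [N' _ N'P] := ucvg.
have := N'P (maxn N N') (leq_maxr _ _).
have := uP (maxn N N') h.
set n := maxn N N' => un_f un_lim.
have : g < g.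
  have gE : f h - inner h (lim (u @ \oo)) =
    (f h - inner h (u n)) - inner h (lim (u @ \oo) - u n).
    by rewrite ipBr; ring.
  rewrite {1}/g gE; apply: le_lt_trans (ler_normB _ _) _.
  apply: (@le_lt_trans _ _ (e * `|h| + `|h| * e)).
    apply: lerD.
      apply: le_trans un_f _; rewrite ler_wpM2r//; apply: le_trans (ltW Ne).
      by rewrite lecR lef_pV2 ?posrE// ler_nat ltnS leq_maxl.
    by apply: le_trans (norm_ip_le _ _) _; rewrite ler_wpM2l// ltW.
  by rewrite [`|h| * _]mulrC -mulr2n -[X in _ < X]eE ltrMn2r/= ltr_pM2l// ltrDl.
by rewrite ltxx.
Qed.

End Functional.
End Riesz.

(** * Bounded operators and adjoints *)

Section BoundedOperators.
Context (R : realType) (H : completeNormedModType R[i]).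
Context (inner : {dot H for @Num.conj R[i]}).
Context (norm_inner : forall x : H, `|x| = sqrtC (inner x x)).
Implicit Types S T W X : H -> H.

Lemma bounded_op_le T : bounded_op T ->
  exists2 M : R[i], 0 <= M & forall x, `|T x| <= M * `|x|.
Proof.
move=> [/linear_pack[L ->] /linear_bounded_continuous/linear_boundedP].
by move=> /pinfty_ex_gt0[M M0 LM]; exists M; rewrite ?ltW.
Qed.

Lemma bounded_op_of_le T (M : R[i]) : 0 <= M -> linear T ->
  (forall x, `|T x| <= M * `|x|) -> bounded_op T.
Proof.
move=> M0 linT TM; split => //; have [L TL] := linear_pack linT.
rewrite TL; apply/linear_bounded_continuous/linear_boundedP; near=> r => x.
rewrite -TL; apply: le_trans (TM x) _; apply: ler_wpM2r => //.
by near: r; apply: nbhs_pinfty_ge; rewrite ger0_real.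
Unshelve. all: by end_near. Qed.

Lemma bounded_op_id : bounded_op (idfun : H -> H).
Proof. by split => // x; exact: cvg_id. Qed.

Lemma bounded_op_comp S T : bounded_op S -> bounded_op T -> bounded_op (S \o T).
Proof.
move=> [linS cS] [linT cT]; split=> [a u v|x] /=; first by rewrite linT linS.
by apply: continuous_comp; [exact: cT|exact: cS].
Qed.

Lemma bounded_op_sub S T : bounded_op S -> bounded_op T -> bounded_op (S \- T).
Proof.
move=> [linS cS] [linT cT]; split=> [a u v|x] /=; last first.
  by apply: continuousB; [exact: cS|exact: cT].
by rewrite linT linS scalerBr opprD addrACA.
Qed.

Lemma bounded_op_add S T : bounded_op S -> bounded_op T -> bounded_op (S \+ T).
Proof.
move=> [linS cS] [linT cT]; split=> [a u v|x] /=; last first.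
  by apply: continuousD; [exact: cS|exact: cT].
by rewrite linT linS scalerDr addrACA.
Qed.

Lemma bounded_op_rank_one (u z : H) : bounded_op (fun y => inner y u *: z).
Proof.
apply: (@bounded_op_of_le _ (`|u| * `|z|)); first by rewrite mulr_ge0.
  by move=> a x y; rewrite ipDl ipZl scalerDl scalerA.
by move=> y; rewrite normrZ mulrAC [`|u| * _]mulrC ler_wpM2r// norm_ip_le.
Qed.

(** Riesz applied to [fun x => inner (T x) y] for each [y]: the chosen value in
    the definition of [adjoint] is a genuine adjoint. *)
Lemma adjointP T : bounded_op T ->
  forall x y, inner (T x) y = inner x (adjoint inner T y).
Proof.
move=> bT; rewrite /adjoint.
apply: (@xgetPex _ (fun=> 0) [set S | forall x y, inner (T x) y = inner x (S y)]).
have [M M0 TM] := bounded_op_le bT.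
suff /choice[S SP] (y : H) : exists s, forall x, inner (T x) y = inner x s.
  by exists S => x y.
apply: (@riesz _ _ _ norm_inner (fun x => inner (T x) y) _ (M * `|y|)).
- by move=> a u v /=; rewrite bT.1 ipDl ipZl.
- by rewrite mulr_ge0.
- move=> x; apply: le_trans (norm_ip_le norm_inner _ _) _.
  by rewrite mulrAC ler_wpM2r.
Qed.

(** With [S] the adjoint, [|S y|^2 = inner (T (S y)) y <= M |S y| |y|]. *)
Lemma adjoint_bounded T : bounded_op T -> bounded_op (adjoint inner T).
Proof.
move=> bT; have adjT := adjointP bT; have [M M0 TM] := bounded_op_le bT.
apply: (bounded_op_of_le M0) => [a u v|y].
  apply/eqP; rewrite -subr_eq0; apply/eqP; apply: (@ip_eq0 _ _ inner) => x.
  rewrite ipC ipBr ipDr ipZr -!adjT ipDr ipZr subrr.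
  exact: conjC0.
have [->|Sy0] := eqVneq (adjoint inner T y) 0; first by rewrite normr0 mulr_ge0.
rewrite -normr_gt0 in Sy0; rewrite -(ler_pM2r Sy0) -expr2 -(ip_norm norm_inner).
rewrite -(ger0_norm (dnorm_ge0 _ _)) -adjT.
apply: le_trans (norm_ip_le norm_inner _ _) _.
by rewrite mulrAC ler_wpM2r.
Qed.

(** A positive operator whose opposite is positive has zero quadratic form. *)
Lemma op_le_anti S T : op_le inner S T -> op_le inner T S -> S = T.
Proof.
move=> [bTS TS] [_ ST]; apply/funext => x; apply/esym/eqP.
rewrite -subr_eq0; apply/eqP.
apply: (positive_form_eq0 bTS.1 TS); apply/eqP; rewrite eq_le TS andbT.
by rewrite -oppr_ge0 -linearNl opprB; exact: ST.
Qed.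

Lemma op_max_unique (E : set (H -> H)) S T :
  op_max inner E S -> op_max inner E T -> S = T.
Proof. by move=> [ES maxS] [ET maxT]; apply: op_le_anti; auto. Qed.

(** * The shorted operator of a compatible pair *)

Section Compatible.
Context (W Q : H -> H) (W_pos : positive_op inner W) (bQ : bounded_op Q).
Context (QQ : forall x, Q (Q x) = Q x).
Context (WQ : forall x y, inner (W (Q x)) y = inner (W x) (Q y)).

Let linW : linear W := W_pos.1.1.

Let linQ : linear Q := bQ.1.

Let QB x y : Q (x - y) = Q x - Q y. Proof. exact: linear_sub. Qed.

Let WB x y : W (x - y) = W x - W y. Proof. exact: linear_sub. Qed.

Lemma compatible_orthogonal x y : inner (W (x - Q x)) (Q y) = 0.
Proof. by rewrite -WQ QB QQ subrr -(subrr 0) WB subrr ip0l. Qed.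

Lemma compatible_pythagoras u : inner (W u) u =
  inner (W (Q u)) (Q u) + inner (W (u - Q u)) (u - Q u).
Proof.
rewrite ipBr compatible_orthogonal subr0 WQ QQ -WQ.
by rewrite WB ipBl addrC subrK.
Qed.

Lemma shorted_form x :
  inner (W (x - Q x)) x = inner (W (x - Q x)) (x - Q x).
Proof. by rewrite ipBr compatible_orthogonal subr0. Qed.

(** [W (1 - Q)] is positive and below [W] because [W (1 - Q)] and [W Q] have the
    quadratic forms of [W] at [x - Q x] and at [Q x]. Maximality: a competitor
    [X] kills [Q x], so its form at [x] is its form at [x - Q x], and there it is
    dominated by that of [W]. *)
Lemma shorted_compatible :
  shorted inner W (range Q) = W \o (idfun \- Q).
Proof.
have bIQ : bounded_op (idfun \- Q) := bounded_op_sub bounded_op_id bQ.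
have bWIQ := bounded_op_comp W_pos.1 bIQ.
have bWQ := bounded_op_comp W_pos.1 bQ.
rewrite /shorted; set E := (X in xget _ (op_max _ X)).
suff maxE : op_max inner E (W \o (idfun \- Q)).
  apply: (op_max_unique _ maxE); apply: (@xgetPex _ (fun=> 0) (op_max inner E)).
  by exists (W \o (idfun \- Q)).
split.
  split => //.
  - have -> : op_le inner (fun=> 0) (W \o (idfun \- Q)) =
      positive_op inner (W \o (idfun \- Q)).
      by congr (positive_op _ _); apply/funext => x /=; rewrite subr0.
    by split => // x /=; rewrite shorted_form; exact: W_pos.2.
  - have -> : op_le inner (W \o (idfun \- Q)) W = positive_op inner (W \o Q).
      by congr (positive_op _ _); apply/funext => x /=; rewrite WB subKr.
    by split => // x /=; rewrite -QQ WQ; exact: W_pos.2.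
  - move=> _ [y _ <-] _ [x _ <-] /=.
    by rewrite ipC compatible_orthogonal conjC0.
move=> X [bX X0 XW Xperp]; split; first exact: bounded_op_sub.
have X_ge0 z : 0 <= inner (X z) z by have := X0.2 z; rewrite /= subr0.
have XQ z y : inner (X z) (Q y) = 0.
  by rewrite ipC (Xperp (X z)) ?conjC0.
move=> x /=; rewrite ipBl shorted_form.
have -> : inner (X x) x = inner (X (x - Q x)) (x - Q x).
  rewrite ipBr XQ subr0 [RHS](positive_form_hermitian bX.1 X_ge0).
  rewrite ipBl [inner (Q x) _]ipC XQ conjC0 subr0.
  exact: positive_form_hermitian bX.1 X_ge0 _ _.
by rewrite -ipBl; exact: XW.2.
Qed.

End Compatible.

End BoundedOperators.

(** * Residual operators and the normal equation *)

Section Residual.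
Context (R : realType) (H : completeNormedModType R[i]).
Context (inner : {dot H for @Num.conj R[i]}).
Context (norm_inner : forall x : H, `|x| = sqrtC (inner x x)).
Context (A W : H -> H) (bA : bounded_op A) (W_pos : positive_op inner W).

(** By adjunction [W Q = Q^* W] says that [Q] is symmetric for the form of [W],
    a formulation free of adjoints. *)
Lemma compatibleP (S : set H) : compatible inner W S ->
  exists Q : H -> H, [/\ bounded_op Q, forall x, Q (Q x) = Q x,
    range Q = S & forall x y, inner (W (Q x)) y = inner (W x) (Q y)].
Proof.
move=> [Q [bQ QQ QS QW]]; exists Q; split=> // [x|x y].
  exact: (congr1 (@^~ x) QQ).
have -> : W (Q x) = adjoint inner Q (W x) := congr1 (@^~ x) QW.
by rewrite ipC -(adjointP norm_inner bQ) -ipC.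
Qed.

Lemma bounded_op_residual X : bounded_op X -> bounded_op (A \o X \- idfun).
Proof.
move=> bX; apply: bounded_op_sub; last exact: bounded_op_id.
exact: bounded_op_comp.
Qed.

Lemma residual_bounded X : bounded_op X -> bounded_op (residual_op inner A W X).
Proof.
move=> /bounded_op_residual bAX; apply: bounded_op_comp => //.
by apply: bounded_op_comp W_pos.1; exact: adjoint_bounded.
Qed.

Lemma residual_form X x y : bounded_op X ->
  inner (residual_op inner A W X x) y =
  inner (W (A (X x) - x)) (A (X y) - y).
Proof.
move=> /bounded_op_residual bAX.
by rewrite ipC -(adjointP norm_inner bAX) -ipC.
Qed.

Lemma normal_equationP X :
  normal_equation inner A W X <->
  forall x y, inner (W (A (X x) - x)) (A y) = 0.
Proof.
split=> [eqX x y|orthX].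
  rewrite ipC (adjointP norm_inner bA).
  have -> : adjoint inner A (W (A (X x) - x)) = 0 := congr1 (@^~ x) eqX.
  by rewrite ip0r conjC0.
apply/funext => x; apply: (@ip_eq0 _ _ inner) => y.
by rewrite ipC -(adjointP norm_inner bA) -ipC; exact: orthX.
Qed.

(** Minimality in the operator order compares [X0] with bounded operators, while
    a [W]-inverse is compared with vectors [z] separately for each [x]. The
    rank-one update below moves the value at [x] from [X0 x] to [z]. *)
Lemma W_inverse_of_min X0 : bounded_op X0 ->
  op_min inner (residual_op inner A W @` @bounded_op R H)
    (residual_op inner A W X0) ->
  W_inverse inner W A X0.
Proof.
move=> bX0 [_ minX0]; split => // x z.
rewrite /seminorm_op ler_sqrtC ?nnegrE ?W_pos.2//.
have [->|x0] := eqVneq x 0.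
  have op0 (T : H -> H) : bounded_op T -> T 0 = 0.
    by move=> [/linear_pack[L ->] _]; exact: linear0.
  by rewrite (op0 X0)// (op0 A)// subr0 (op0 W W_pos.1) ip0l; exact: W_pos.2.
(* [y |-> inner y (x / <x, x>)] is the bounded functional equal to [1] at [x]. *)
pose X := X0 \+ (fun y => inner y ((inner x x)^-1 *: x) *: (z - X0 x)).
have bX : bounded_op X.
  by apply: bounded_op_add => //; exact: bounded_op_rank_one.
have Xx : X x = z.
  rewrite /X/= ipZr fmorphV/= -ipC mulVf ?dnorm_eq0// scale1r.
  by rewrite addrC subrK.
have [] := minX0 _ (ex_intro2 _ _ X bX erefl) => _ /(_ x).
by rewrite /= ipBl subr_ge0 !residual_form// Xx.
Qed.

(** Moving [z] along [X0 x + t y] moves the residual along the line with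
    direction [A y], on which it is minimal at [t = 0]. *)
Lemma normal_equation_of_W_inverse X0 :
  W_inverse inner W A X0 -> normal_equation inner A W X0.
Proof.
move=> [bX0 minX0]; apply/normal_equationP => x y.
apply: (positive_form_min W_pos.1.1 W_pos.2) => t.
rewrite addrAC [_ + t *: _]addrC -bA.1.
have := minX0 x (t *: y + X0 x).
by rewrite /seminorm_op ler_sqrtC ?nnegrE ?W_pos.2.
Qed.

Section Projection.
Context (Q : H -> H) (bQ : bounded_op Q).
Context (QQ : forall x, Q (Q x) = Q x) (QA : range Q = range A).
Context (WQ : forall x y, inner (W (Q x)) y = inner (W x) (Q y)).

Lemma projection_range x : Q (A x) = A x.
Proof.
have : range A (A x) by exists x.
by rewrite -QA => -[y _ <-]; rewrite QQ.
Qed.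

(** The component of the residual along [range A] only increases the form, and
    the other component [- (x - Q x)] does not depend on [X]. *)
Lemma shorted_le_residual X : bounded_op X ->
  op_le inner (W \o (idfun \- Q)) (residual_op inner A W X).
Proof.
move=> bX; split.
  apply: bounded_op_sub; first exact: residual_bounded.
  apply: bounded_op_comp W_pos.1 _.
  by apply: bounded_op_sub => //; exact: bounded_op_id.
move=> x /=; rewrite ipBl subr_ge0 residual_form//.
rewrite (shorted_form W_pos bQ QQ WQ).
rewrite (compatible_pythagoras W_pos bQ QQ WQ (A (X x) - x)).
have -> : A (X x) - x - Q (A (X x) - x) = - (x - Q x).
  by rewrite (linear_sub _ _ bQ.1) projection_range !opprB addrC addrA subrK.
have -> : inner (W (- (x - Q x))) (- (x - Q x)) =
    inner (W (x - Q x)) (x - Q x).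
  by have [L ->] := linear_pack W_pos.1.1; rewrite (linearN L) linearNl linearNr opprK.
by rewrite lerDr; exact: W_pos.2.
Qed.

(** Both [A (X x) - x] and [Q x - x] are [W]-orthogonal to [range A], and their
    difference lies in [range A]; thus [W] does not distinguish them. *)
Lemma residual_of_normal_equation X : bounded_op X ->
  normal_equation inner A W X ->
  residual_op inner A W X = W \o (idfun \- Q).
Proof.
move=> bX /normal_equationP orthX; apply/funext => x.
have orthQ y z : inner (W (y - Q y)) (A z) = 0.
  by rewrite -projection_range (compatible_orthogonal W_pos bQ QQ WQ).
have [y _ Qx] : range A (Q x) by rewrite -QA; exists x.
have W0 : W (A (X x) - Q x) = 0.
  apply: (positive_form_eq0 W_pos.1.1 W_pos.2).
  have -> : inner (W (A (X x) - Q x)) (A (X x) - Q x) =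
            inner (W (A (X x) - Q x)) (A (X x - y)).
    by congr (inner _ _); rewrite -Qx (linear_sub _ _ bA.1).
  have -> : A (X x) - Q x = (A (X x) - x) + (x - Q x) by rewrite addrA subrK.
  have [LW WE] := linear_pack W_pos.1.1.
  by rewrite WE linearD -WE ipDl orthX orthQ addr0.
have WX : W (A (X x) - x) = - W (x - Q x).
  have -> : A (X x) - x = (A (X x) - Q x) - (x - Q x).
    by rewrite opprB addrA subrK.
  by rewrite (linear_sub _ _ W_pos.1.1) W0 sub0r.
apply/eqP; rewrite -subr_eq0; apply/eqP; apply: (@ip_eq0 _ _ inner) => z.
rewrite ipBl residual_form// ipBr orthX sub0r WX -linearNl opprK.
exact: subrr.
Qed.

End Projection.
End Residual.

Theorem proposition3p3 (R : realType) (H : completeNormedModType R[i])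
  (inner : {dot H for @Num.conj R[i]})
  (norm_inner : forall x : H, `|x| = sqrtC (inner x x))
  (separableH : separable H)
  (A W : H -> H) (boundedA : bounded_op A) (closedA : closed (range A))
  (positiveW : positive_op inner W) (compatWA : compatible inner W (range A))
  (X0 : H -> H) (boundedX0 : bounded_op X0) :
  [<-> residual_shorted inner A W X0;
       op_min inner (residual_op inner A W @` @bounded_op R H)
         (residual_op inner A W X0);
       W_inverse inner W A X0;
       normal_equation inner A W X0].
Proof.
have [Q [bQ QQ QA WQ]] := compatibleP norm_inner compatWA.
have shortedE : shorted inner W (range A) = W \o (idfun \- Q).
  by rewrite -QA; exact: shorted_compatible.
tfae.
- move=> [_ FX0]; split; first by exists X0.
  move=> _ [X bX <-]; rewrite FX0 shortedE.
  exact: shorted_le_residual.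
- exact: W_inverse_of_min.
- exact: normal_equation_of_W_inverse.
- move=> normalX0; split=> //; rewrite shortedE.
  exact: residual_of_normal_equation.
Qed.
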